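(* Let $K$ be an infinite field and let $L_n$ be an $n$-dimensional null-filiform Leibniz algebra over $K$. Then the polynomials $$x_1(x_2x_3)\qquad\text{and}\qquad x_1x_2x_3\cdots x_n-x_2x_1x_3\cdots x_n$$ are a minimal basis of $\mathrm{Id}(L_n)$.
   Context: A Leibniz algebra over $K$ is a (not necessarily associative) $K$-algebra satisfying $x(yz)=(xy)z-(xz)y$ for all $x,y,z$. For a Leibniz algebra $L$ put $L^1=L$ and $L^{k+1}=L^kL$. An $n$-dimensional Leibniz algebra $L$ is null-filiform if $\dim L^i=n+1-i$ for $1\le i\le n+1$. It is known that every $n$-dimensional null-filiform Leibniz algebra is isomorphic to the algebra with basis $e_1,\dots,e_n$ and products $e_ie_1=e_{i+1}$ for $1\le i\le n-1$, all other products of basis elements being zero. Let $X=\{x_1,x_2,\dots\}$ be a countably infinite set and $\mathcal D(X)$ the free Leibniz $K$-algebra on $X$, i.e. the Leibniz algebra generated by $X$ such that every map from $X$ to a Leibniz algebra $L$ extends uniquely to an algebra homomorphism $\mathcal D(X)\to L$. Its elements are called polynomials. Products written without brackets are left-normed: $y_1y_2\cdots y_m=(\cdots((y_1y_2)y_3)\cdots)y_m$. A polynomial $f$ is a polynomial identity of $L$ if it lies in the kernel of every homomorphism $\mathcal D(X)\to L$, and $\mathrm{Id}(L)$ is the set of all polynomial identities of $L$. A T-ideal of $\mathcal D(X)$ is an ideal invariant under all endomorphisms of $\mathcal D(X)$. For $S\subseteq \mathcal D(X)$, $\langle S\rangle^T$ is the intersection of all T-ideals containing $S$. A subset $S\subseteq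 \mathrm{Id}(L)$ is a basis of $\mathrm{Id}(L)$ if $\mathrm{Id}(L)=\langle S\rangle^T$. A basis of $\mathrm{Id}(L)$ is minimal if it does not properly contain a basis of $\mathrm{Id}(L)$.
   Formalization: Taken for n ≥ 2 (the second polynomial is undefined for n = 1); minimality is claimed only for n ≥ 3 or char K = 2, since for n = 2 and char K ≠ 2 the identity x_1x_2 − x_2x_1 already implies x_1(x_2x_3), so the basis is not minimal. *)

(* Defs.v *)
From HB Require Import structures.
From mathcomp Require Import all_boot all_order all_algebra.
From mathcomp Require Import boolp classical_sets functions cardinality.

Set Implicit Arguments.
Unset Strict Implicit.
Unset Printing Implicit Defensive.

Import GRing.Theory.
Local Open Scope classical_set_scope.
Local Open Scope ring_scope.

Reserved Notation "x ** y" (at level 40, left associativity).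

HB.mixin Record Lmodule_isLeibniz (K : fieldType) L of GRing.Lmodule K L := {
  lmul : L -> L -> L;
  lmul_linearl : forall z, linear (fun x => lmul x z);
  lmul_linearr : forall z, linear (lmul z);
  leibniz_identity : forall x y z,
    lmul x (lmul y z) = lmul (lmul x y) z - lmul (lmul x z) y
}.

#[short(type="leibnizType")]
HB.structure Definition Leibniz (K : fieldType) :=
  {L of GRing.Lmodule K L & Lmodule_isLeibniz K L}.

#[short(type="finLeibnizType")]
HB.structure Definition FinLeibniz (K : fieldType) :=
  {L of Vector K L & Lmodule_isLeibniz K L}.

Notation "x ** y" := (lmul x y) : ring_scope.

Definition leibniz_hom (K : fieldType) (A B : leibnizType K) (f : A -> B) :=
  linear f /\ {morph f : a b / a ** b}.

(* Generation of D by the x i is part of the uniqueness of the extension. *)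
Definition free_leibniz (K : fieldType) (D : leibnizType K) (x : nat -> D) :=
  forall (A : leibnizType K) (v : nat -> A),
    exists! f : D -> A, leibniz_hom f /\ forall i, f (x i) = v i.

Section NullFiliform.
Variables (K : fieldType) (L : finLeibnizType K).

Definition leib_prodv (U V : {vspace L}) : {vspace L} :=
  <<[seq u ** v | u <- vbasis U, v <- vbasis V]>>%VS.

(* The choice of bases is irrelevant: leib_prodv U V is the smallest subspace
   containing all products of elements of U and V. *)
Lemma leib_prodvP (U V W : {vspace L}) :
  reflect (forall u v, u \in U -> v \in V -> u ** v \in W)
          (leib_prodv U V <= W)%VS.
Proof.
apply: (iffP span_subvP) => [sW u v uU vV|sW w].
  pose fl z : {linear L -> L} :=
    HB.pack (fun x : L => x ** z) (GRing.isLinear.Build _ _ _ _ _ (lmul_linearl z)).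
  pose fr z : {linear L -> L} :=
    HB.pack (fun x : L => z ** x) (GRing.isLinear.Build _ _ _ _ _ (lmul_linearr z)).
  rewrite (coord_vbasis uU) -[_ ** v]/(fl v _) linear_sum.
  apply: memv_suml => i _; rewrite linearZ memvZ //= -[_ ** v]/(fr _ v).
  rewrite (coord_vbasis vV) linear_sum; apply: memv_suml => j _.
  rewrite linearZ memvZ //=; apply: sW.
  by apply: allpairs_f; rewrite mem_nth ?size_tuple.
by case/allpairsP => -[u v] [/= uU vV ->]; apply: sW; exact: vbasis_mem.
Qed.

(* lpow k is L^k for k >= 1 (lpow 0 = L is a junk value). *)
Definition lpow (k : nat) : {vspace L} :=
  iter k.-1 (fun U => leib_prodv U fullv) fullv.

Definition null_filiform (n : nat) :=
  \dim {:L} = n /\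
  forall i, (1 <= i <= n.+1)%N -> \dim (lpow i) = (n.+1 - i)%N.

End NullFiliform.

Section Identities.
Variables (K : fieldType) (D : leibnizType K).

Definition ideal (I : set D) :=
  [/\ I 0,
      forall (c : K) a b, I a -> I b -> I (c *: a + b) &
      forall a b, I a -> I (a ** b) /\ I (b ** a)].

Definition T_ideal (I : set D) :=
  ideal I /\
  forall phi : D -> D, leibniz_hom phi -> forall a, I a -> I (phi a).

Definition T_span (S : set D) : set D := smallest T_ideal S.

Definition Id (L : leibnizType K) : set D :=
  [set f | forall phi : D -> L, leibniz_hom phi -> phi f = 0].

Definition is_basis (L : leibnizType K) (S : set D) :=
  S `<=` Id L /\ Id L = T_span S.

Definition minimal_basis (L : leibnizType K) (S : set D) :=
  is_basis L S /\ forall B : set D, B `<` S -> ~ is_basis L B.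

Definition leftnormed (y : D) (s : seq D) : D := foldl (fun a b => a ** b) y s.

(* Generators are numbered from 0: x i stands for x_{i+1}. *)
Definition poly_right (x : nat -> D) : D := x 0%N ** (x 1%N ** x 2%N).

(* x_1 x_2 x_3 ... x_n - x_2 x_1 x_3 ... x_n, meaningful for n >= 2 *)
Definition poly_swap (x : nat -> D) (n : nat) : D :=
  leftnormed (x 0%N) (x 1%N :: [seq x i | i <- iota 2 (n - 2)]) -
  leftnormed (x 1%N) (x 0%N :: [seq x i | i <- iota 2 (n - 2)]).

End Identities.

(* Main.v *)
Require Import Defs.
From HB Require Import structures.
From mathcomp Require Import all_boot all_order all_algebra.
From mathcomp Require Import ring.
From mathcomp Require Import boolp classical_sets functions cardinality.

Set Implicit Arguments.
Unset Strict Implicit.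
Unset Printing Implicit Defensive.

Import GRing.Theory.
Local Open Scope classical_set_scope.
Local Open Scope ring_scope.

(** The inclusion of the two polynomials in Id(L) comes from the structure of L.
A null-filiform algebra has a basis e, e^2, ..., e^n of left-normed powers of one
element e ([null_filiform_basis]), and every e^k with k >= 2 annihilates L from
the right.  Hence y z = lambda(z) (y e), where lambda(z) is the coordinate of z
on e ([fmulE]).  As lambda vanishes on products, y (z w) = 0; and a product of n
factors equals the product of their lambda-coordinates times e^n, which is
symmetric in all the factors ([null_filiform_swap]).

Conversely, let T be a T-ideal inside Id(L) that contains the two polynomials.
Modulo T, the first one makes D spanned by the left-normed monomials
x_i x_{j_1} ... x_{j_m} ([mod_monomials_all]) and lets j_1, ..., j_m be permuted ([leftnormed_perm]).
The second one makes monomials with at least n factors symmetric in all of them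
([leftnormed_perm_cons]) and kills those with more than n factors
([leftnormed_long]).  So a polynomial is, modulo T, a combination of monomials of
degree at most n, and only the sum of the coefficients over each class of
monomials congruent for these reasons matters ([T_ideal_sum_by_key]).  For an
identity of L each of these sums vanishes ([Id_coef_key]): substituting
x_i |-> a_i e + b_i e^2 gives
  x_i x_{j_1} ... x_{j_m} |-> a_{j_1} ... a_{j_m} (a_i e^{m+1} + b_i e^{m+2}),
and distinct monomials in the parameters a_j are linearly independent functions
over an infinite field ([monomial_functions_free]).  The term in b_i singles out
the first factor as long as m + 2 <= n; for m + 1 = n it disappears, exactly when
the first factor has become exchangeable with the others.  Taking T to be the
T-ideal spanned by the two polynomials gives the equality with Id(L).

For minimality, no consequence of a set S can be an identity that fails in an
algebra in which S holds ([not_T_span]), so it suffices to find, for each of the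
two polynomials, a Leibniz algebra that satisfies it but not the other one
([two_dim_leibniz], [five_dim_leibniz]). *)

(** * Leibniz algebras and their homomorphisms *)

Section LeibnizTheory.
Variables (K : fieldType) (A : leibnizType K).
Implicit Types (a b c : A) (s : seq A).

(** Right multiplication as a function of its left factor, named so that it can
carry a linear structure; its iterates give left-normed powers. *)
Definition rmul b a := a ** b.
HB.instance Definition _ b :=
  GRing.isLinear.Build K A A _ (rmul b) (lmul_linearl b).
HB.instance Definition _ a :=
  GRing.isLinear.Build K A A _ (lmul a) (lmul_linearr a).

Lemma lmulDl b : {morph (fun a => a ** b) : a c / a + c}.
Proof. exact: (raddfD (rmul b)). Qed.
Lemma lmulBl b : {morph (fun a => a ** b) : a c / a - c}.
Proof. exact: (raddfB (rmul b)). Qed.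
Lemma lmulZl k a b : (k *: a) ** b = k *: (a ** b).
Proof. exact: (linearZ_LR (rmul b)). Qed.
Lemma lmul0l b : 0 ** b = 0.
Proof. exact: (raddf0 (rmul b)). Qed.
Lemma lmulDr a : {morph (lmul a) : b c / b + c}.
Proof. exact: raddfD. Qed.
Lemma lmulZr k a b : a ** (k *: b) = k *: (a ** b).
Proof. exact: (linearZ_LR (lmul a)). Qed.
Lemma lmulBr a : {morph (lmul a) : b c / b - c}.
Proof. exact: raddfB. Qed.
End LeibnizTheory.


(** * Generation of a free Leibniz algebra *)

Record subalgebra (K : fieldType) (A : leibnizType K) := Subalgebra {
  subalg_set :> A -> Prop;
  subalg0 : subalg_set 0;
  subalgP : forall (k : K) a b,
    subalg_set a -> subalg_set b -> subalg_set (k *: a + b);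
  subalgM : forall a b, subalg_set a -> subalg_set b -> subalg_set (a ** b)
}.

Section Subalgebra.
Variables (K : fieldType) (A : leibnizType K) (S : subalgebra A).

(** A subalgebra is turned into a Leibniz algebra of its own, so that it can be
the target of a homomorphism out of a free algebra. *)
Definition in_subalg : pred A := fun a => `[< S a >].

Fact in_subalg_closed : submod_closed in_subalg.
Proof.
split=> [|k a b /asboolP Sa /asboolP Sb]; apply/asboolP; first exact: subalg0.
exact: subalgP.
Qed.
HB.instance Definition _ :=
  GRing.isSubmodClosed.Build K A in_subalg in_subalg_closed.

Definition subalg_type := {a | in_subalg a}.
HB.instance Definition _ := SubChoice.on subalg_type.
HB.instance Definition _ := [SubChoice_isSubLmodule of subalg_type by <:].

Fact subalg_mul_subproof (a b : subalg_type) : in_subalg (val a ** val b).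
Proof.
by apply/asboolP/subalgM; apply/asboolP; [exact: (svalP a) | exact: (svalP b)].
Qed.
Definition subalg_mul a b : subalg_type := Sub _ (subalg_mul_subproof a b).

Fact subalg_mul_linearl b : linear (fun a => subalg_mul a b).
Proof. by move=> k a c; apply/val_inj; rewrite /= lmulDl lmulZl. Qed.
Fact subalg_mul_linearr a : linear (subalg_mul a).
Proof. by move=> k b c; apply/val_inj; rewrite /= lmulDr lmulZr. Qed.
Fact subalg_leibniz a b c : subalg_mul a (subalg_mul b c) =
  subalg_mul (subalg_mul a b) c - subalg_mul (subalg_mul a c) b.
Proof. by apply/val_inj; rewrite /= leibniz_identity. Qed.
HB.instance Definition _ := Lmodule_isLeibniz.Build K subalg_type
  subalg_mul_linearl subalg_mul_linearr subalg_leibniz.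
End Subalgebra.

(** The extension D -> S of the generators, followed by the inclusion of S into
D, is an endomorphism that fixes the generators, hence is the identity by
uniqueness; so D has its values in S. *)
Lemma free_leibniz_generated (K : fieldType) (D : leibnizType K) (x : nat -> D)
    (S : subalgebra D) :
  free_leibniz x -> (forall i, S (x i)) -> forall a, S a.
Proof.
move=> x_free Sx a.
have Sx' i : in_subalg S (x i) by apply/asboolP.
have [f [[[f_lin f_mul] fx] _]] :=
  x_free (subalg_type S : leibnizType K) (fun i => Sub (x i) (Sx' i)).
have [g [_ g_uniq]] := x_free D x.
have gf : g = val \o f.
  apply: g_uniq; split=> [|i]; last by rewrite /= fx SubK.
  split=> [k b c|b c] /=; first by rewrite f_lin.
  by rewrite f_mul.
have gid : g = id by apply: g_uniq; split.
have <- : val (f a) = a by have /(congr1 (@^~ a)) := etrans (esym gf) gid.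
by apply/asboolP; exact: (svalP (f a)).
Qed.

(** * T-ideals *)

Lemma hom_leftnormed (K : fieldType) (A B : leibnizType K) (f : A -> B) y s :
  leibniz_hom f -> f (leftnormed y s) = leftnormed (f y) (map f s).
Proof. by move=> [_ fM]; elim: s y => //= z s IHs y; rewrite IHs fM. Qed.

Section TIdeals.
Variables (K : fieldType) (D : leibnizType K).
Implicit Types (I S : set D) (a b c : D).

Lemma hom0 (A : leibnizType K) (f : D -> A) : leibniz_hom f -> f 0 = 0.
Proof.
by case=> f_lin _; have := f_lin (-1) 0 0; rewrite scaler0 addr0 scaleN1r addNr.
Qed.

Lemma Id_T_ideal (A : leibnizType K) : T_ideal (Id (D := D) A).
Proof.
split; first split=> [f /hom0 //|k a b Ia Ib f f_hom|a b Ia].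
- by rewrite f_hom.1 Ia ?Ib // scaler0 addr0.
- by split=> f f_hom; rewrite f_hom.2 (Ia f) ?lmul0l // raddf0.
- move=> f f_hom a Ia g g_hom; apply: (Ia (g \o f)); split=> [k b c|b c] /=.
    by rewrite f_hom.1 g_hom.1.
  by rewrite f_hom.2 g_hom.2.
Qed.

Lemma T_span_T_ideal S : T_ideal (T_span S).
Proof.
split; first split=> [I /= [[[I0 _ _] _] _] //|k a b Sa Sb I II|a b Sa].
- by have /= [[[_ IP _] _] _] := II; apply: IP; [exact: Sa | exact: Sb].
- by split=> I II; have /= [[[_ _ IM] _] _] := II; have [] := IM a b (Sa _ II).
- by move=> f f_hom a Sa I II; have /= [[_ If] _] := II;
     apply: If => //; exact: Sa.
Qed.

(** Soundness of consequences: it suffices to check the members of S in A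
because Id A is itself a T-ideal. *)
Lemma T_span_sub_Id (A : leibnizType K) S :
  S `<=` Id A -> T_span S `<=` Id A.
Proof. by move=> SA; apply: smallest_sub => //; exact: Id_T_ideal. Qed.
End TIdeals.

Lemma free_leibniz_hom (K : fieldType) (D : leibnizType K) (x : nat -> D)
    (A : leibnizType K) (v : nat -> A) :
  free_leibniz x -> exists2 f : D -> A, leibniz_hom f & forall i, f (x i) = v i.
Proof. by move=> /(_ A v)[f [[]]]; exists f. Qed.


(** * The basis of a null-filiform algebra *)

Section NullFiliformBasis.
Variables (K : fieldType) (L : finLeibnizType K) (n : nat).
Implicit Types (u v x y z : L) (k : nat).

Lemma memv_lpowM k u v : u \in lpow L k.+1 -> u ** v \in lpow L k.+2.
Proof.
move=> uP; apply: (leib_prodvP _ _ _ (subvv (lpow L k.+2))) => //.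
exact: memvf.
Qed.

(** By the Leibniz identity u (y z) = (u y) z - (u z) y, a product on the right
costs two right multiplications, that is, two steps of the lower central
series. *)
Lemma memv_lpowM2 k u v :
  u \in lpow L k.+1 -> v \in lpow L 2 -> u ** v \in lpow L k.+3.
Proof.
move=> uP; pose W := (linfun (lmul u) @^-1: lpow L k.+3)%VS.
suff /subvP sW : (lpow L 2 <= W)%VS by move=> /sW; rewrite -memv_preim lfunE.
apply/leib_prodvP => y z _ _; rewrite -memv_preim lfunE /= leibniz_identity.
by rewrite rpredB ?memv_lpowM.
Qed.

(** The exponent is shifted: [rpow e k] is e^(k+1). *)
Definition rpow (e : L) k := iter k (rmul e) e.

(** Both base case and step are instances of x (y e) = (x y) e - (x e) y, in
which the two terms cancel for y = e and vanish by induction for y a higher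
power. *)
Lemma rpow_annihilates e x k : x ** rpow e k.+1 = 0.
Proof.
elim: k x => [|k IHk] x; rewrite /= /rmul leibniz_identity ?subrr //.
by rewrite !IHk lmul0l subrr.
Qed.

Lemma rpow_eq0 e i j : (i <= j)%N -> rpow e i = 0 -> rpow e j = 0.
Proof.
move=> /subnK <- ei0; elim: (j - i)%N => //= k ->.
exact: lmul0l.
Qed.

Hypotheses (n_gt0 : (0 < n)%N) (L_nf : null_filiform L n).

Lemma dim_lpowS k : (k <= n)%N -> \dim (lpow L k.+1) = (n - k)%N.
Proof. by move=> kn; have [_ ->] := L_nf; rewrite ?ltnS. Qed.

(** L^2 has codimension one, so any vector outside L^2 spans a complement of
it. *)
Lemma null_filiform_generator : exists e, ({:L} <= <[e]> + lpow L 2)%VS.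
Proof.
have dim2 : (\dim (lpow L 2)).+1 = n by rewrite dim_lpowS ?subn1 ?prednK.
have /subvPn[e _ eN2] : ~~ ({:L} <= lpow L 2)%VS.
  by apply/negP => /dimvS; rewrite L_nf.1 leqNgt -[X in (_ < X)%N]dim2 leqnn.
exists e; suff /eqP-> : (<[e]> + lpow L 2)%VS == fullv by exact: subvv.
rewrite eqEdim subvf L_nf.1 -[X in (X <= _)%N]dim2.
rewrite (ltn_leqif (dimv_leqif_eq (addvSr _ _))).
apply: contra eN2 => /eqP ->.
by rewrite (subvP (addvSl _ _)) ?memv_line.
Qed.

(** The generator e satisfies L^k <= K e^k + L^(k+1) for every k, because (K
e^k + L^(k+1)) (K e + L^2) is contained in K e^(k+1) + L^(k+2) by
[memv_lpowM2]. Adding up these inclusions, and since L^(n+1) = 0, the n powers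
of e span L, whose dimension is n. *)
Lemma null_filiform_basis :
  exists2 e, rpow e n = 0 & basis_of {:L} (mkseq (rpow e) n).
Proof.
have [e genL] := null_filiform_generator.
have eP k : rpow e k \in lpow L k.+1.
  by elim: k => [|k IHk]; [exact: memvf | exact: memv_lpowM].
have stepP k : (lpow L k.+1 <= <[rpow e k]> + lpow L k.+2)%VS.
  elim: k => [//|k IHk]; apply/leib_prodvP => u v uP _.
  (* u = a [rpow e k] + u' and v = b e + v', where u' and v' lie one step
     further down the lower central series. *)
  have /memv_addP[_ /vlineP[a ->] [u' u'P ->]] := subvP IHk _ uP.
  have /memv_addP[_ /vlineP[b ->] [v' v'P ->]] := subvP genL v (memvf v).
  rewrite lmulDl lmulDr -addrA lmulZl lmulZr scalerA.
  rewrite memv_add ?memvZ ?memv_line //.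
  by rewrite lmulZl rpredD ?memv_lpowM // memvZ ?memv_lpowM2.
have lpow0 : lpow L n.+1 = 0%VS.
  by apply/eqP; rewrite -dimv_eq0 dim_lpowS ?subnn.
exists e; first by apply/eqP; rewrite -memv0 -lpow0 eP.
have spanP k : ({:L} <= <<mkseq (rpow e) k>> + lpow L k.+1)%VS.
  elim: k => [|k IHk]; first exact: addvSr.
  rewrite (subv_trans IHk) // mkseqS -cats1 span_cat span_seq1 -addvA.
  by rewrite addvS ?stepP.
by rewrite basisEdim size_mkseq L_nf.1 leqnn andbT -[<<_>>%VS]addv0 -lpow0.
Qed.
End NullFiliformBasis.

(** A null-filiform algebra in coordinates. The indices are shifted by one:
[fvec i] stands for e^(i+1), which is 0 for i >= n, and [fcoord 0] is the
linear form that governs right multiplication. *)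
Record null_filiform_frame (K : fieldType) (L : finLeibnizType K) n := Frame {
  fvec : nat -> L;
  fcoord : nat -> {scalar L};
  fcoordK : forall y, y = \sum_(i < n) fcoord i y *: fvec i;
  fcoord_vec : forall i j, (i < n)%N -> fcoord i (fvec j) = (i == j)%:R;
  fvec_eq0 : forall i, (n <= i)%N -> fvec i = 0;
  fvecS : forall i, fvec i ** fvec 0 = fvec i.+1;
  fmulE : forall y z, y ** z = fcoord 0 z *: (y ** fvec 0)
}.

Lemma null_filiform_frameP (K : fieldType) (L : finLeibnizType K) n :
  (0 < n)%N -> null_filiform L n -> inhabited (null_filiform_frame L n).
Proof.
case: n => // n _ L_nf; have [e en0 eB] := null_filiform_basis (ltn0Sn n) L_nf.
have szE : size (mkseq (rpow e) n.+1) == n.+1 by rewrite size_mkseq.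
pose X := Tuple szE.
pose d i : {scalar L} := coord X (inord i).
have XE (i : 'I_n.+1) : X`_i = rpow e i by rewrite nth_mkseq.
have eB' : basis_of {:L} X by [].
have dK y : y = \sum_(i < n.+1) d i y *: rpow e i.
  rewrite [LHS](coord_basis eB' (memvf y)); apply: eq_bigr => i _.
  by rewrite XE /d inord_val.
have e0 i : (n.+1 <= i)%N -> rpow e i = 0 by move=> ni; exact: rpow_eq0 en0.
split; exists (rpow e) d => //.
- move=> i j ltin; have [ltjn|lenj] := ltnP j n.+1; last first.
    by rewrite e0 // linear0 ltn_eqF ?(leq_trans ltin).
  have -> : d i (rpow e j) = coord X (inord i) X`_(Ordinal ltjn) by rewrite XE.
  by rewrite coord_free ?(basis_free eB') // eq_sym -val_eqE /= inordK.
- move=> y z; rewrite [z in LHS]dK raddf_sum big_ord_recl /=.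
  rewrite big1 ?addr0 ?lmulZr //.
  by move=> i _; rewrite lmulZr rpow_annihilates scaler0.
Qed.

(** * Identities of null-filiform algebras *)

Section FrameProducts.
Variables (K : fieldType) (L : finLeibnizType K) (n : nat).
Variable F : null_filiform_frame L n.
Local Notation E := (fvec F).
Local Notation crd := (fcoord F).

Fact iter_rmul_linear m (e : L) : linear (iter m (rmul e)).
Proof. by elim: m => // m IHm k a b /=; rewrite IHm linearP. Qed.
HB.instance Definition _ m e :=
  GRing.isLinear.Build K L L _ (iter m (rmul e)) (iter_rmul_linear m e).

Lemma iter_rmul_fvec m i : iter m (rmul (E 0)) (E i) = E (i + m).
Proof. by elim: m => [|m IHm]; rewrite ?addn0 //= IHm /rmul fvecS addnS. Qed.

Lemma iter_rmulE m y :
  iter m (rmul (E 0)) y = \sum_(i < n) crd i y *: E (i + m).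
Proof.
rewrite [in LHS](fcoordK F y) linear_sum; apply: eq_bigr => i _.
by rewrite linearZ /= iter_rmul_fvec.
Qed.

Lemma leftnormed_frame y s :
  leftnormed y s = (\prod_(z <- s) crd 0 z) *: iter (size s) (rmul (E 0)) y.
Proof.
elim: s y => [|z s IHs] y /=; first by rewrite big_nil scale1r.
rewrite IHs (fmulE F y z) linearZ scalerA big_cons mulrC; congr (_ *: _).
exact: (esym (iterSr _ (rmul (E 0)) y)).
Qed.

Hypothesis n_gt0 : (0 < n)%N.

Lemma fcoord0_mul y z : crd 0 (y ** z) = 0.
Proof.
rewrite (fmulE F) -[y ** _]/(iter 1 (rmul (E 0)) y) iter_rmulE linearZ linear_sum.
by rewrite big1 /= ?mulr0 // => i _; rewrite linearZ /= fcoord_vec // addn1 mulr0.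
Qed.

Lemma null_filiform_lmul_mul a b c : a ** (b ** c) = 0 :> L.
Proof. by rewrite (fmulE F) fcoord0_mul scale0r. Qed.

(** Right multiplication by e, iterated n - 1 times, sends y to its
e-coordinate times e^n; so both sides are the product of the e-coordinates of
all n factors times e^n. *)
Lemma null_filiform_swap a b s : size s = (n - 2)%N -> (2 <= n)%N ->
  leftnormed a (b :: s) = leftnormed b (a :: s) :> L.
Proof.
move=> sz n2; have topP y : iter n.-1 (rmul (E 0)) y = crd 0 y *: E n.-1.
  rewrite iter_rmulE (bigD1 (Ordinal n_gt0)) //= big1 ?addr0 // => i i_neq0.
  rewrite fvec_eq0 ?scaler0 // -ltnS -addnS prednK //.
  by rewrite -[X in (X < _)%N]add0n ltn_add2r lt0n -val_eqE in i_neq0 *.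
have szE c : size (c :: s) = n.-1 by rewrite /= sz -subSn // subSS subn1.
rewrite !leftnormed_frame !szE !topP.
by rewrite !big_cons !scalerA; congr (_ *: _); ring.
Qed.

Lemma basis_sub_Id (D : leibnizType K) (x : nat -> D) : (2 <= n)%N ->
  [set poly_right x; poly_swap x n] `<=` Id L.
Proof.
move=> n2 _ [->|->] f f_hom; first by rewrite !f_hom.2 null_filiform_lmul_mul.
have [f_lin _] := f_hom.
rewrite /poly_swap -scaleN1r addrC f_lin !(hom_leftnormed _ _ f_hom) !map_cons.
rewrite null_filiform_swap ?size_map ?size_iota //.
by rewrite scaleN1r addNr.
Qed.
End FrameProducts.


(** * Congruence modulo a T-ideal *)

Section Congruence.
Variables (K : fieldType) (D : leibnizType K) (T : set D) (T_T : T_ideal T).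
Implicit Types (a b c : D) (s : seq D).

Lemma T_ideal0 : T 0. Proof. by case: T_T.1. Qed.
Lemma T_idealP (k : K) a b : T a -> T b -> T (k *: a + b).
Proof. by case: T_T.1 => _ + _; apply. Qed.
Lemma T_idealZ (k : K) a : T a -> T (k *: a).
Proof. by move=> Ta; rewrite -[_ *: _]addr0; exact/T_idealP/T_ideal0. Qed.
Lemma T_idealD a b : T a -> T b -> T (a + b).
Proof. by move=> Ta; rewrite -[a]scale1r; exact: T_idealP. Qed.
Lemma T_idealN a : T a -> T (- a).
Proof. by rewrite -scaleN1r; exact: T_idealZ. Qed.
Lemma T_idealMr a b : T a -> T (a ** b).
Proof. by case: T_T.1 => _ _ TM /(TM a b)[]. Qed.
Lemma T_ideal_sum (I : eqType) (r : seq I) (P : pred I) (F : I -> D) :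
  (forall i, i \in r -> P i -> T (F i)) -> T (\sum_(i <- r | P i) F i).
Proof.
move=> TF; rewrite big_seq_cond; apply: (big_ind T T_ideal0 T_idealD) => i /andP[].
exact: TF.
Qed.

Definition cong a b := T (a - b).

Lemma cong_refl a : cong a a. Proof. by rewrite /cong subrr; exact: T_ideal0. Qed.
Lemma cong_sym a b : cong a b -> cong b a.
Proof. by rewrite /cong -(opprB a b); exact: T_idealN. Qed.
Lemma cong_trans b a c : cong a b -> cong b c -> cong a c.
Proof. by rewrite /cong => Tab /(T_idealD Tab); rewrite addrA subrK. Qed.

Lemma T_ideal_cong a b : cong a b -> T b -> T a.
Proof. by rewrite /cong => Tab /(T_idealD Tab); rewrite subrK. Qed.

Lemma T_ideal_leftnormed a s : T a -> T (leftnormed a s).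
Proof. by elim: s a => //= b s IHs a Ta; apply: IHs; exact: T_idealMr. Qed.

Lemma leftnormedB s : {morph (leftnormed (D := D))^~ s : a b / a - b}.
Proof. by elim: s => //= c s IHs a b; rewrite lmulBl IHs. Qed.

Lemma cong_leftnormed s a b :
  cong a b -> cong (leftnormed a s) (leftnormed b s).
Proof. by rewrite /cong -leftnormedB; exact: T_ideal_leftnormed. Qed.

(** Within a class of congruent terms, all of them may be replaced by one
representative, whose total coefficient is zero. *)
Lemma T_ideal_sum_by_key (I kT : eqType) (r : seq I) (c : I -> K) (m : I -> D)
    (key : I -> kT) :
  (forall p q, key p = key q -> cong (m p) (m q)) ->
  (forall p, p \in r -> \sum_(q <- r | key q == key p) c q = 0) ->
  T (\sum_(p <- r) c p *: m p).
Proof.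
move=> key_cong; move: {2}(size r) (leqnn (size r)) => N.
elim: N r => [[]//|N IHN [|p r]] ler c0; rewrite ?big_nil; try exact: T_ideal0.
rewrite (bigID (fun q => key q == key p)) /=; apply: T_idealD.
  rewrite (eq_bigr (fun q => c q *: (m q - m p) + c q *: m p)) => [|q _].
    rewrite big_split /= -scaler_suml c0 ?mem_head // scale0r addr0.
    by apply: T_ideal_sum => q _ /eqP/key_cong; exact: T_idealZ.
  by rewrite -scalerDr subrK.
rewrite -big_filter; apply: IHN => [|q].
  by rewrite /= eqxx /= size_filter (leq_trans (count_size _ _)).
rewrite mem_filter => /andP[kqp qr].
rewrite big_filter_cond -[RHS](c0 q qr); apply: eq_bigl => i.
by rewrite andbC; case: eqP => //= ->.
Qed.

Section RightIdentity.
Hypothesis T_right : forall a b c, T (a ** (b ** c)).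

(** The difference of the two sides is a (b c), by the Leibniz identity. *)
Lemma cong_lmulAC a b c : cong (a ** b ** c) (a ** c ** b).
Proof. by rewrite /cong -leibniz_identity. Qed.

Lemma leftnormed_last a b s :
  cong (leftnormed a (b :: s)) (leftnormed a s ** b).
Proof.
elim: s a => [|c s IHs] a; first exact: cong_refl.
apply: (cong_trans (b := leftnormed a [:: c, b & s])); last exact: IHs.
exact/(cong_leftnormed s)/cong_lmulAC.
Qed.

Lemma leftnormed_perm a s s' :
  perm_eq s s' -> cong (leftnormed a s) (leftnormed a s').
Proof.
elim: s a s' => [|b s IHs] a s' ss'.
  by move: ss'; rewrite perm_sym => /perm_nilP->; exact: cong_refl.
have bs' : b \in s' by rewrite -(perm_mem ss') mem_head.
case/splitPr: bs' ss' => s1 s2; rewrite perm_sym perm_catC /= perm_cons => ss.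
have {}ss : perm_eq s (s1 ++ s2) by rewrite perm_sym perm_catC.
apply: (cong_trans (IHs _ _ ss)); rewrite /leftnormed !foldl_cat.
exact/(cong_leftnormed s2)/leftnormed_last.
Qed.

Variable n : nat.
Hypothesis T_swap : forall a b s, size s = (n - 2)%N ->
  cong (leftnormed a (b :: s)) (leftnormed b (a :: s)).

Lemma leftnormed_swap a b s : (n - 2 <= size s)%N ->
  cong (leftnormed a (b :: s)) (leftnormed b (a :: s)).
Proof.
move=> les; rewrite -(cat_take_drop (n - 2) s) -!cat_cons /leftnormed !foldl_cat.
by apply/cong_leftnormed/T_swap; rewrite size_takel.
Qed.

(** If the first factors a and b differ, then a occurs among the later factors
on the right and b among those on the left; bring both next to the front and
swap them. *)
Lemma leftnormed_perm_cons a b s s' : (n - 1 <= size s)%N ->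
  perm_eq (a :: s) (b :: s') -> cong (leftnormed a s) (leftnormed b s').
Proof.
move=> les abss'; have [ab|neqab] := eqVneq a b.
  by rewrite -ab in abss' *; apply: leftnormed_perm; rewrite -(perm_cons a).
have /perm_to_rem ss1 : a \in s'.
  by have := perm_mem abss' a; rewrite mem_head in_cons (negPf neqab).
have {}abss' : perm_eq s (b :: rem a s').
  rewrite -(perm_cons a) (permPl abss') perm_sym.
  rewrite -[X in perm_eq X _]/([:: a] ++ [:: b] ++ rem a s') perm_catCA /=.
  by rewrite perm_cons perm_sym.
apply: (cong_trans (b := leftnormed a (b :: rem a s'))).
  exact: leftnormed_perm.
apply: (cong_trans (b := leftnormed b (a :: rem a s'))); last first.
  by apply: cong_sym; apply: leftnormed_perm.
by apply: leftnormed_swap; move: les; rewrite (perm_size abss') !leq_subLR.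
Qed.

(** For s = b c ..., apply the swap to a b and c: the result starts with c (a
b), which lies in T. *)
Lemma leftnormed_long a s : (2 <= n)%N -> (n <= size s)%N -> T (leftnormed a s).
Proof.
case: s => [|b [|c s]] /= n2; [by rewrite leqNgt ltnW|by rewrite leqNgt n2|].
move=> les; apply: (T_ideal_cong (b := leftnormed c (a ** b :: s))).
  by apply: leftnormed_swap; rewrite leq_subLR.
exact: (T_ideal_leftnormed s (T_right c a b)).
Qed.
End RightIdentity.
End Congruence.

(** * Left-normed monomials span modulo the T-ideal *)

(** The pair (i, [:: j_1; ...; j_m]) encodes x_i x_{j_1} ... x_{j_m}. *)
Definition monomial (K : fieldType) (D : leibnizType K) (x : nat -> D)
  (p : nat * seq nat) : D := leftnormed (x p.1) [seq x j | j <- p.2].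

Section Spanning.
Variables (K : fieldType) (D : leibnizType K) (x : nat -> D).
Variables (x_free : free_leibniz x) (T : set D) (T_T : T_ideal T).
Hypothesis T_right : forall a b c, T (a ** (b ** c)).

Definition mod_monomials (a : D) := exists r : seq (K * (nat * seq nat)),
  cong T a (\sum_(p <- r) p.1 *: monomial x p.2).

Lemma mod_monomialsT a : T a -> mod_monomials a.
Proof. by exists [::]; rewrite big_nil /cong subr0. Qed.

Lemma mod_monomialsP k a b :
  mod_monomials a -> mod_monomials b -> mod_monomials (k *: a + b).
Proof.
move=> [ra Ta] [rb Tb]; exists ([seq (k * p.1, p.2) | p <- ra] ++ rb).
rewrite big_cat big_map /=; under eq_bigr do rewrite -scalerA.
rewrite -scaler_sumr /cong opprD addrACA -scalerBr; exact: T_idealP.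
Qed.

Lemma mod_monomials_sum (r : seq (K * (nat * seq nat))) (F : nat * seq nat -> D) :
  (forall p, mod_monomials (F p)) ->
  mod_monomials (\sum_(p <- r) p.1 *: F p.2).
Proof.
move=> FM; elim: r => [|p r IHr].
  by rewrite big_nil; exact: mod_monomialsT (T_ideal0 T_T).
by rewrite big_cons; exact: mod_monomialsP.
Qed.

Lemma mod_monomials_cong a b : cong T a b -> mod_monomials b -> mod_monomials a.
Proof.
move=> Tab bM; rewrite -(subrK b a) -[a - b]scale1r.
exact/mod_monomialsP/bM/mod_monomialsT.
Qed.

Lemma mod_monomials_monomial p : mod_monomials (monomial x p).
Proof.
exists [:: (1, p)]; rewrite big_seq1 scale1r; exact: cong_refl.
Qed.

(** Only right factors of degree one survive: a monomial of degree at least two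
has the form c x_k, and a (c x_k) lies in T. *)
Lemma mod_monomialsM a b :
  mod_monomials a -> mod_monomials b -> mod_monomials (a ** b).
Proof.
move=> [ra Ta] [rb Tb].
have TMl c d : T d -> T (c ** d) by case: T_T.1 => _ _ TM /(TM d c)[].
apply: (mod_monomials_cong (b := a ** \sum_(q <- rb) q.1 *: monomial x q.2)).
  by rewrite /cong -lmulBr; exact: TMl.
rewrite raddf_sum; under eq_bigr do rewrite /= lmulZr.
apply: (mod_monomials_sum _ (F := fun q => a ** monomial x q)) => -[j s].
case/lastP: s => [|s k]; last first.
  apply: mod_monomialsT; rewrite /monomial /leftnormed map_rcons foldl_rcons.
  exact: T_right.
apply: (mod_monomials_cong (b := (\sum_(p <- ra) p.1 *: monomial x p.2) ** x j)).
  by rewrite /cong -[monomial _ _]/(x j) -lmulBl; exact: T_idealMr.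
rewrite -[_ ** _]/(rmul (x j) _) linear_sum; under eq_bigr do rewrite linearZ.
apply: (mod_monomials_sum _ (F := fun p => monomial x p ** x j)) => -[i s].
apply: mod_monomials_cong (mod_monomials_monomial (i, rcons s j)).
rewrite /monomial /leftnormed map_rcons foldl_rcons; exact: cong_refl.
Qed.

Definition monomial_subalgebra : subalgebra D :=
  Subalgebra (mod_monomialsT (T_ideal0 T_T)) mod_monomialsP mod_monomialsM.

Lemma mod_monomials_all a : mod_monomials a.
Proof.
apply: (free_leibniz_generated (S := monomial_subalgebra) x_free) => i.
exact: (mod_monomials_monomial (i, [::])).
Qed.

Lemma T_ideal_right : T (poly_right x) -> forall a b c, T (a ** (b ** c)).
Proof.
move=> Tr a b c.
have [f f_hom fx] := free_leibniz_hom (nth 0 [:: a; b; c]) x_free.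
by have := T_T.2 f f_hom _ Tr; rewrite !f_hom.2 !fx.
Qed.

Lemma T_ideal_swap n : T (poly_swap x n) -> forall a b s, size s = (n - 2)%N ->
  cong T (leftnormed a (b :: s)) (leftnormed b (a :: s)).
Proof.
move=> Ts a b s sz.
have [f f_hom fx] := free_leibniz_hom (nth 0 [:: a, b & s]) x_free.
have := T_T.2 f f_hom _ Ts.
rewrite /poly_swap -scaleN1r addrC f_hom.1 scaleN1r addrC.
rewrite !(hom_leftnormed _ _ f_hom) /= !fx -map_comp.
suff -> : map (f \o x) (iota 2 (n - 2)) = s by [].
apply: (eq_from_nth (x0 := 0)); rewrite size_map size_iota // => i lti.
by rewrite (nth_map 0%N) ?size_iota //= fx nth_iota.
Qed.
End Spanning.

(** * Independence of monomial functions *)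

Section MonomialFunctions.
Variables (K : fieldType) (K_infinite : infinite_set [set: K]).

(** A nonzero polynomial has fewer roots than its size, and K has more elements
than that. *)
Lemma poly_eq0_of_horner (q : {poly K}) : (forall t, q.[t] = 0) -> q = 0.
Proof.
move=> q0; apply/eqP/negPn/negP => q_neq0.
have [B _ leB] := infinite_set_fset (size q) K_infinite.
suff B_roots : all (root q) (finmap.enum_fset B).
  have := max_poly_roots q_neq0 B_roots (finmap.fset_uniq B).
  by rewrite ltnNge leB.
by apply/allP => t _; rewrite rootE q0.
Qed.

(** The variables are separated one at a time: for fixed values of the others,
the sum is a polynomial function of one variable, so over an infinite field
each of its coefficients vanishes. Comparing multisets by [perm_eq] gathers the
terms that carry the same monomial. *)
Lemma monomial_functions_free (I : eqType) (r : seq I) (P : pred I)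
    (c : I -> K) (s : I -> seq nat) :
  (forall a : nat -> K, \sum_(p <- r | P p) c p * \prod_(j <- s p) a j = 0) ->
  forall u, \sum_(p <- r | P p && perm_eq (s p) u) c p = 0.
Proof.
move=> s0 u; pose Q N p :=
  all (fun j => count_mem j (s p) == count_mem j u) (iota 0 N).
(* After N steps only the terms with the same exponents as u in the variables of
   index below N are left, and these variables have been removed. *)
have sQ N (a : nat -> K) : \sum_(p <- r | P p && Q N p)
    c p * \prod_(j <- s p | (N <= j)%N) a j = 0.
  elim: N a => [|N IHN] a.
    by under eq_bigl do rewrite andbT; exact: s0.
  pose q := \sum_(p <- r | P p && Q N p)
    (c p * \prod_(j <- s p | (N < j)%N) a j) *: 'X^(count_mem N (s p)).
  have q_eq0 : q = 0.
    apply: poly_eq0_of_horner => t.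
    rewrite -[RHS](IHN (fun j => if j == N then t else a j)) horner_sum.
    apply: eq_bigr => p _; rewrite hornerZ hornerXn -mulrA; congr (_ * _).
    rewrite [RHS](bigID (pred1 N)) /= mulrC; congr (_ * _).
      rewrite (eq_bigl (pred1 N)) => [|j]; last first.
        by rewrite /=; case: eqP => [->|]; rewrite ?leqnn ?andbF.
      rewrite (eq_bigr (fun=> t)) => [|j /eqP->]; last by rewrite eqxx.
      by rewrite big_const_seq iter_mulr_1.
    apply: eq_big => [j|j]; first by rewrite ltn_neqAle eq_sym andbC.
    by move=> /gtn_eqF->.
  have /(congr1 (fun q : {poly K} => q`_(count_mem N u))) := q_eq0.
  rewrite coef0 => q0; rewrite -[RHS]q0 coef_sum [RHS]big_mkcond [LHS]big_mkcond.
  apply: eq_bigr => p _; rewrite coefZ coefXn /Q -addn1 iotaD all_cat /= andbT.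
  rewrite andbA eq_sym; case: (P p && _) => //=.
  by case: eqP; rewrite ?mulr1 ?mulr0.
pose N := (\max_(j <- flatten (u :: map s r)) j).+1.
have ltN j p : p \in r -> j \in s p ++ u -> (j < N)%N.
  move=> pr jsu; rewrite ltnS; apply: (@leq_bigmax_seq _ _ xpredT id j) => //=.
  move: jsu; rewrite !mem_cat orbC => /orP[->//|js]; apply/orP; right.
  by apply/flattenP; exists (s p) => //; exact: map_f.
rewrite -[RHS](sQ N (fun=> 0)) [LHS]big_seq_cond [RHS]big_seq_cond.
apply: eq_big => [p|p /andP[pr _]].
  case pr : (p \in r) => //=; congr (_ && _); apply/idP/idP.
    by move=> /permP su; apply/allP => j _; rewrite su.
  move=> /allP QN; apply/allP => j jsu; apply: QN.
  by rewrite mem_iota (ltN j p).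
rewrite big_seq_cond big_pred0 ?mulr1 // => j.
by case js : (j \in s p); rewrite //= leqNgt (ltN j p) // mem_cat js.
Qed.
End MonomialFunctions.

(** * Coefficients of the identities *)

(** Monomials with the same key are congruent: below degree n the first index
and the multiset of the others, from degree n on the multiset of all indices.
*)
Definition monomial_key n (p : nat * seq nat) : option nat * seq nat :=
  if (size p.2 < n.-1)%N then (Some p.1, sort leq p.2)
  else (None, sort leq (p.1 :: p.2)).

Lemma eq_sort_perm (s t : seq nat) : (sort leq s == sort leq t) = perm_eq s t.
Proof.
by apply/eqP/idP => /perm_sortP; apply; [exact: leq_total | exact: leq_trans |
  exact: anti_leq | exact: leq_total | exact: leq_trans | exact: anti_leq].
Qed.

Lemma monomial_key_short n p q : (size p.2 < n.-1)%N ->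
  (monomial_key n q == monomial_key n p) =
  [&& size q.2 == size p.2, q.1 == p.1 & perm_eq q.2 p.2].
Proof.
move=> ltp; rewrite /monomial_key ltp; case: ifP => ltq.
  rewrite xpair_eqE eq_sort_perm (inj_eq Some_inj).
  by case: (boolP (perm_eq _ _)) => [/perm_size->|]; rewrite ?eqxx ?andbT ?andbF.
rewrite xpair_eqE /=; apply/esym/negP => /and3P[/eqP sz _ _].
by rewrite sz ltp in ltq.
Qed.

Lemma monomial_key_long n p q : (n.-1 <= size p.2)%N ->
  (monomial_key n q == monomial_key n p) =
  (size q.2 == size p.2) && perm_eq (q.1 :: q.2) (p.1 :: p.2).
Proof.
move=> lep; rewrite /monomial_key (ltnNge (size p.2)) lep /=; case: ifP => ltq.
  rewrite xpair_eqE /=; apply/esym/negP => /andP[/eqP sz _].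
  by rewrite sz ltnNge lep in ltq.
rewrite xpair_eqE eq_sort_perm /=.
by case: (boolP (perm_eq _ _)) => [/perm_size[->]|]; rewrite ?eqxx ?andbF.
Qed.

Lemma cong_monomial_key (K : fieldType) (D : leibnizType K) (x : nat -> D)
    (T : set D) n : T_ideal T -> (forall a b c, T (a ** (b ** c))) ->
  (forall a b s, size s = (n - 2)%N ->
    cong T (leftnormed a (b :: s)) (leftnormed b (a :: s))) ->
  forall p q, monomial_key n p = monomial_key n q ->
    cong T (monomial x p) (monomial x q).
Proof.
move=> T_T T_right T_swap p q /eqP.
have [ltq|leq] := ltnP (size q.2) n.-1.
  rewrite monomial_key_short // => /and3P[_ /eqP pq1 pq2].
  by rewrite /monomial pq1; apply: leftnormed_perm => //; exact: perm_map.
rewrite monomial_key_long // => /andP[/eqP sz pq].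
apply: (leftnormed_perm_cons T_T T_right T_swap).
  by rewrite size_map sz subn1.
by rewrite -!map_cons; exact: perm_map.
Qed.

Section IdentityCoefficients.
Variables (K : fieldType) (L : finLeibnizType K) (n : nat).
Variables (F : null_filiform_frame L n) (n_ge2 : (2 <= n)%N).
Variables (D : leibnizType K) (x : nat -> D) (x_free : free_leibniz x).
Hypothesis K_infinite : infinite_set [set: K].
Local Notation E := (fvec F).
Local Notation crd := (fcoord F).

Lemma hom_monomial (f : D -> L) (a b : nat -> K) p : leibniz_hom f ->
  (forall i, f (x i) = a i *: E 0 + b i *: E 1) ->
  f (monomial x p) = (\prod_(j <- p.2) a j) *:
    (a p.1 *: E (size p.2) + b p.1 *: E (size p.2).+1).
Proof.
move=> f_hom fx; rewrite hom_leftnormed // (leftnormed_frame F) !size_map fx.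
congr (_ *: _); last by rewrite linearP linearZ /= !iter_rmul_fvec.
rewrite !big_map; apply: eq_bigr => j _; rewrite fx linearP linearZ /=.
by rewrite !fcoord_vec ?(ltnW n_ge2) // mulr1 mulr0 addr0.
Qed.

Variable r : seq (K * (nat * seq nat)).
Hypothesis r_Id : Id L (\sum_(p <- r) p.1 *: monomial x p.2).

(** The coordinate on e^(l+1) of the value of the combination under x_i |-> a_i
e + b_i e^2. *)
Lemma Id_eval (a b : nat -> K) l : (l < n)%N ->
  \sum_(p <- r) p.1 * (\prod_(j <- p.2.2) a j *
    (a p.2.1 * (l == size p.2.2)%:R + b p.2.1 * (l == (size p.2.2).+1)%:R)) = 0.
Proof.
move=> ltl.
have [f f_hom fx] := free_leibniz_hom (fun i => a i *: E 0 + b i *: E 1) x_free.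
pose fL : {linear D -> L} := HB.pack f (GRing.isLinear.Build _ _ _ _ f f_hom.1).
rewrite -[RHS](linear0 (crd l)) -[in RHS](r_Id f_hom) -[f]/(fL : D -> L).
rewrite !linear_sum; apply: eq_bigr => p _; rewrite !linearZ /=; congr (_ * _).
rewrite (hom_monomial _ f_hom fx) linearZ linearP linearZ /=.
by rewrite !fcoord_vec.
Qed.

(** Setting b = 0 leaves, on e^(l+1), the monomials of degree l + 1, each with
the commutative monomial in all its indices. *)
Lemma Id_coef_sym l u : (l < n)%N ->
  \sum_(p <- r | (size p.2.2 == l) && perm_eq (p.2.1 :: p.2.2) u) p.1 = 0.
Proof.
move=> ltl; apply: (monomial_functions_free K_infinite) => a.
rewrite -[RHS](Id_eval a (fun=> 0) ltl) big_mkcond; apply: eq_bigr => p _.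
rewrite mul0r addr0 big_cons eq_sym [a _ * _]mulrC.
by case: eqP; rewrite ?mulr1 ?mulr0.
Qed.

(** Subtracting the value at b = 0 from the value at the indicator function b
of i leaves the terms with first index i, whose first factor became e^2; they
survive because e^(l+2) is nonzero. *)
Lemma Id_coef_head l i u : (l.+1 < n)%N ->
  \sum_(p <- r | [&& size p.2.2 == l, p.2.1 == i & perm_eq p.2.2 u]) p.1 = 0.
Proof.
move=> ltl; under eq_bigl do rewrite andbA.
apply: (monomial_functions_free K_infinite) => a.
rewrite -[RHS](subrr 0) -[X in X - _](Id_eval a (fun j => (j == i)%:R) ltl).
rewrite -[X in _ - X](Id_eval a (fun=> 0) ltl) -sumrB big_mkcond.
apply: eq_bigr => p _; rewrite mul0r addr0 -!mulrBr [in RHS]addrC addKr.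
rewrite eqSS eq_sym; case: eqP; case: eqP; rewrite /= ?mulr1 ?mulr0 //.
Qed.

Lemma Id_coef_key p : (size p.2 < n)%N ->
  \sum_(q <- r | monomial_key n q.2 == monomial_key n p) q.1 = 0.
Proof.
move=> ltp; have [lt1|le1] := ltnP (size p.2) n.-1.
  under eq_bigl do rewrite monomial_key_short //.
  by apply: Id_coef_head; rewrite -ltn_predRL.
under eq_bigl do rewrite monomial_key_long //.
exact: Id_coef_sym.
Qed.
End IdentityCoefficients.

(** Modulo T an identity a of L is a combination of monomials of degree at most
n; this combination is still an identity of L, so its coefficients cancel
within each class of congruent monomials. *)
Lemma Id_sub_T_ideal (K : fieldType) (L : finLeibnizType K) n
    (D : leibnizType K) (x : nat -> D) (T : set D) :
  infinite_set [set: K] -> (2 <= n)%N -> null_filiform_frame L n ->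
  free_leibniz x -> T_ideal T -> T `<=` Id L ->
  T (poly_right x) -> T (poly_swap x n) -> Id L `<=` T.
Proof.
move=> K_inf n2 F x_free T_T sTI /(T_ideal_right x_free T_T) T_right.
move=> /(T_ideal_swap x_free T_T) T_swap a aI.
have [r0 Ta] := mod_monomials_all x_free T_T T_right a.
pose r := [seq p <- r0 | (size p.2.2 < n)%N].
have {}Ta : cong T a (\sum_(p <- r) p.1 *: monomial x p.2).
  apply: (cong_trans T_T Ta).
  rewrite /cong (bigID (fun p => (size p.2.2 < n)%N)) /= -big_filter addrC addrK.
  apply: (T_ideal_sum T_T) => p _; rewrite -leqNgt => len.
  apply: (T_idealZ T_T); apply: (leftnormed_long T_T T_right T_swap) => //.
  by rewrite size_map.
have rI : Id L (\sum_(p <- r) p.1 *: monomial x p.2).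
  have [[_ IP _] _] := Id_T_ideal D L.
  by rewrite -[X in Id L X](subKr a) -scaleN1r addrC; apply: IP => //; exact: sTI.
apply: (T_ideal_cong T_T Ta).
apply: (T_ideal_sum_by_key T_T (key := fun p => monomial_key n p.2)).
  by move=> p q; exact: cong_monomial_key.
move=> p; rewrite mem_filter => /andP[ltp _].
exact: (Id_coef_key F n2 x_free K_inf rI).
Qed.

(** * Independence of the two identities *)

Section Models.
Variable K : fieldType.

(** The algebra with basis e, u and products e u = alpha u, u e = u. The
Leibniz identity amounts to alpha (alpha + 1) = 0. For alpha = 0 it satisfies y
(z w) = 0 but right multiplication by e is not nilpotent; alpha = 1 is allowed
in characteristic 2 only and gives the non-abelian Lie algebra of dimension 2,
which is commutative there. *)
Lemma two_dim_leibniz (alpha : K) : alpha * alpha = - alpha ->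
  exists (A : leibnizType K) (e u : A),
    [/\ u ** e = u, e ** u = alpha *: u, u != 0,
        alpha = 0 -> forall y z w : A, y ** (z ** w) = 0 &
        alpha = 1 -> forall y z : A, y ** z = z ** y].
Proof.
move=> alpha2; pose V : lmodType K := (K^o * K^o)%type.
pose mul (y z : V) : V := (0, alpha * (y.1 * z.2) + y.2 * z.1).
have mull z : linear (fun y => mul y z).
  by move=> k y w; congr (_, _); rewrite /= /GRing.scale /=; ring.
have mulr y : linear (mul y).
  by move=> k z w; congr (_, _); rewrite /= /GRing.scale /=; ring.
have mul_leibniz y z w : mul y (mul z w) = mul (mul y z) w - mul (mul y w) z.
  congr (_, _); rewrite /= ?subrr //.
  transitivity (alpha * alpha * (y.1 * (z.1 * w.2))
                + alpha * (y.1 * (z.2 * w.1))).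
    by ring.
  by rewrite alpha2; ring.
pose A : leibnizType K :=
  HB.pack V (Lmodule_isLeibniz.Build K V mull mulr mul_leibniz).
exists A, ((1, 0) : V), ((0, 1) : V); split.
- by congr (_, _); rewrite /=; ring.
- by congr (_, _); rewrite /= /GRing.scale /=; ring.
- by rewrite xpair_eqE oner_eq0 andbF.
- by move=> alpha0 y z w; congr (_, _); rewrite alpha0 /=; ring.
- by move=> alpha1 y z; congr (_, _); rewrite alpha1; ring.
Qed.

(** A nilpotent algebra with generators a, b, where a a = s, a b = - b a = k,
and s b = a k = w are the nonzero products of basis vectors. Products of two
elements are symmetric up to k, and k annihilates the algebra from the left,
whence the first property; but a (a b) = a k = w. *)
Lemma five_dim_leibniz : exists A : leibnizType K,
  (forall y z w : A, y ** z ** w = z ** y ** w) /\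
  exists a b : A, a ** (a ** b) != 0.
Proof.
pose V : lmodType K := (K^o * K^o * (K^o * K^o * K^o))%type.
pose ca (y : V) : K := y.1.1; pose cb (y : V) : K := y.1.2.
pose cs (y : V) : K := y.2.1.1; pose ck (y : V) : K := y.2.1.2.
pose mul (y z : V) : V := (0, 0, (ca y * ca z,
  ca y * cb z - cb y * ca z, cs y * cb z + ca y * ck z)).
have mull z : linear (fun y => mul y z).
  by move=> k y w; congr (_, _, (_, _, _));
     rewrite /mul /ca /cb /cs /ck /= /GRing.scale /=; ring.
have mulr y : linear (mul y).
  by move=> k z w; congr (_, _, (_, _, _));
     rewrite /mul /ca /cb /cs /ck /= /GRing.scale /=; ring.
have mul_leibniz y z w : mul y (mul z w) = mul (mul y z) w - mul (mul y w) z.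
  by congr (_, _, (_, _, _)); rewrite /mul /ca /cb /cs /ck /=; ring.
pose A : leibnizType K :=
  HB.pack V (Lmodule_isLeibniz.Build K V mull mulr mul_leibniz).
exists A; split=> [y z w|].
  by congr (_, _, (_, _, _)); rewrite /mul /ca /cb /cs /ck /=; ring.
exists ((1, 0, (0, 0, 0)) : V), ((0, 1, (0, 0, 0)) : V).
rewrite !xpair_eqE negb_and; apply/orP; right; rewrite negb_and; apply/orP; right.
rewrite /mul /ca /cb /cs /ck /= !mulr1 !mul0r subr0 add0r mul1r.
exact: oner_neq0.
Qed.
End Models.

Section Independence.
Variables (K : fieldType) (D : leibnizType K) (x : nat -> D).
Hypothesis x_free : free_leibniz x.

Lemma not_T_span (A : leibnizType K) (v : nat -> A) (S : set D) (g : D) :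
  S `<=` Id A ->
  (forall f : D -> A, leibniz_hom f -> (forall i, f (x i) = v i) -> f g != 0) ->
  ~ T_span S g.
Proof.
move=> SA gv /(T_span_sub_Id SA) gA.
have [f f_hom fx] := free_leibniz_hom v x_free.
by have := gv f f_hom fx; rewrite gA ?eqxx.
Qed.

Lemma hom_poly_swap (A : leibnizType K) (f : D -> A) n : leibniz_hom f ->
  f (poly_swap x n) =
    leftnormed (f (x 0)) (f (x 1) :: [seq f (x i) | i <- iota 2 (n - 2)]) -
    leftnormed (f (x 1)) (f (x 0) :: [seq f (x i) | i <- iota 2 (n - 2)]).
Proof.
move=> f_hom; rewrite /poly_swap -scaleN1r addrC f_hom.1 scaleN1r addrC.
by rewrite !(hom_leftnormed _ _ f_hom) !map_cons -!map_comp.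
Qed.

(** In the model with alpha = 0, u e ... e = u whereas e u = 0. *)
Lemma swap_not_in_T_right n : ~ T_span [set poly_right x] (poly_swap x n).
Proof.
have [|A [e [u [ue eu u_neq0 /(_ erefl) A3 _]]]] := @two_dim_leibniz K 0.
  by rewrite mulr0 oppr0.
pose v i : A := if i == 0%N then u else e.
apply: (@not_T_span A v) => [_ -> f f_hom|f f_hom fx].
  by rewrite !f_hom.2 A3.
rewrite hom_poly_swap // !fx /=.
have ln0 s : leftnormed 0 s = 0 :> A by elim: s => //= w s; rewrite lmul0l.
rewrite eu scale0r -/(leftnormed 0 _) ln0 subr0 ue.
suff -> : [seq f (x i) | i <- iota 2 (n - 2)] = nseq (n - 2) e.
  by elim: (n - 2)%N => //= m; rewrite ue.
set s := map _ _; have sz_s : size s = (n - 2)%N by rewrite size_map size_iota.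
rewrite -[X in nseq X _]sz_s; apply/all_pred1P.
rewrite all_map; apply/allP => -[|i]; rewrite mem_iota //= fx => _.
exact: eqxx.
Qed.

(** For n >= 3, the swapped monomials agree as soon as y z w = z y w. For n = 2
the model has to be commutative with y (z w) not identically zero; in a
commutative Leibniz algebra 2 y (z w) = 0, which is why characteristic 2 is
needed. *)
Lemma right_not_in_T_swap n : (2 <= n)%N -> (3 <= n)%N \/ 2%N \in [pchar K] ->
  ~ T_span [set poly_swap x n] (poly_right x).
Proof.
move=> n2 hn.
suff [A [Aswap [a [b ab]]]] : exists A : leibnizType K,
    (forall f : D -> A, leibniz_hom f -> f (poly_swap x n) = 0) /\
    exists a b : A, a ** (a ** b) != 0.
  apply: (@not_T_span A (nth 0 [:: a; a; b])) => [_ ->|f f_hom fx].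
    exact: Aswap.
  by rewrite !f_hom.2 !fx.
case: (ltnP 2 n) hn => [n3 _|len [|ch2]].
- have [A [Acomm Aneq0]] := five_dim_leibniz K.
  exists A; split=> // f f_hom; rewrite hom_poly_swap //.
  by rewrite -[(n - 2)%N]prednK ?subn_gt0 //= Acomm subrr.
- by [].
have neg1 : -1 = 1 :> K by apply: oppr_pchar2.
have [|A [e [u [ue eu u_neq0 _ Acomm]]]] := @two_dim_leibniz K 1.
  by rewrite mulr1 neg1.
have {len} n_eq2 : n = 2%N by apply/eqP; rewrite eqn_leq len.
exists A; split=> [f f_hom|].
  by rewrite hom_poly_swap // n_eq2 /= Acomm // subrr.
by exists e, u; rewrite eu scale1r eu scale1r.
Qed.
End Independence.


(** * The minimal basis *)

Theorem theorem7 (K : fieldType) (n : nat) (L : finLeibnizType K)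
    (D : leibnizType K) (x : nat -> D)
    (K_infinite : infinite_set [set: K])
    (n_ge2 : (2 <= n)%N)
    (L_null_filiform : null_filiform L n)
    (D_free : free_leibniz x) :
  let F := [set poly_right x; poly_swap x n] in
  is_basis L F /\
  ((3 <= n)%N \/ 2%N \in [pchar K] -> minimal_basis L F).
Proof.
move=> F; have [Fr] := null_filiform_frameP (ltnW n_ge2) L_null_filiform.
have F_Id : F `<=` Id L := basis_sub_Id Fr (ltnW n_ge2) (x := x) n_ge2.
have F_basis : is_basis L F.
  split=> //; apply/seteqP; split; last exact: T_span_sub_Id.
  have sFT : F `<=` T_span F by exact: sub_gen_smallest.
  apply: (Id_sub_T_ideal K_infinite n_ge2 Fr D_free).
  - exact: T_span_T_ideal.
  - exact: T_span_sub_Id.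
  - by apply: sFT; left.
  - by apply: sFT; right.
split=> // hn; split=> // B [sBF nFB] [_ IdB].
have FB a : F a -> T_span B a by rewrite -IdB; exact: F_Id.
have B_mono S : B `<=` S -> T_span B `<=` T_span S.
  by move=> sBS; apply: sub_smallest2r => //; exact: T_span_T_ideal.
have [Br|nBr] := pselect (B (poly_right x)); last first.
  apply: (right_not_in_T_swap D_free n_ge2 hn).
  apply: (B_mono [set poly_swap x n]); last by apply: FB; left.
  by move=> b Bb; case: (sBF b Bb) => // bE; rewrite bE in Bb.
have [Bs|nBs] := pselect (B (poly_swap x n)).
  by apply: nFB => _ [] ->.
apply: (swap_not_in_T_right D_free (n := n)).
apply: (B_mono [set poly_right x]); last by apply: FB; right.
by move=> b Bb; case: (sBF b Bb) => // bE; rewrite bE in Bb.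
Qed.
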